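(* Two reduced linear trellises $T$ and $T'$ of the same length $n$ are linearly isomorphic if and only if for every span $\mathfrak{s}$ both $$\dim\mathbb{S}_{\mathfrak{s}}(T)=\dim\mathbb{S}_{\mathfrak{s}}(T')\quad\text{and}\quad C_{\mathfrak{s}}(T)=C_{\mathfrak{s}}(T')$$ hold. In particular, two one-to-one reduced linear trellises $T,T'$ of the same length are linearly isomorphic if and only if $C_{\mathfrak{s}}(T)=C_{\mathfrak{s}}(T')$ for all spans $\mathfrak{s}$.
   Context: Let $\mathbb{F}$ be a finite field and $n\ge1$; indices are taken in $\mathbb{Z}_n$. A trellis $T$ of length $n$ over $\mathbb{F}$ consists of pairwise disjoint finite vertex sets $V_i(T)$, $i\in\mathbb{Z}_n$, and edge sets $E_i(T)\subseteq V_i(T)\times\mathbb{F}\times V_{i+1}(T)$; $(v,\alpha,w)\in E_i(T)$ is an edge from $v$ to $w$ with label $\alpha$. Trellises are trim (each vertex has an outgoing and an incoming edge). $T$ is linear if each $V_i(T)$ is an $\mathbb{F}$-vector space and each $E_i(T)$ a subspace of $V_i(T)\times\mathbb{F}\times V_{i+1}(T)$. A cycle is a closed path of length $n$ starting in $V_0(T)$, identified with $(\mathbf{v},\boldsymbol{\alpha})\in\prod_iV_i(T)\times\mathbb{F}^n$; $\mathbb{S}(T)$ is the space of cycles, $L(\mathbf{v},\boldsymbol{\alpha})=\boldsymbol{\alpha}$. $T$ is reduced if every edge lies on a cycle, and one-to-one if $L$ is injective on $\mathbb{S}(T)$. A linear isomorphism $f:T\to T'$ is a family of linear bijections $f_i:V_i(T)\to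 V_i(T')$ with $(v,\alpha,w)\in E_i(T)\iff(f_i(v),\alpha,f_{i+1}(w))\in E_i(T')$. Spans: for $a\in\mathbb{Z}_n$, $0\le l\le n-1$, $[a,a+l]=\{a,\dots,a+l\}\subseteq\mathbb{Z}_n$, $(a,a+l]=[a,a+l]\setminus\{a\}$; the pair $(a,l)$ is a span; also degenerate spans $\emptyset$ and $\mathbb{Z}_n$. A nondegenerate $(a,l)$ is a span of a cycle $(\mathbf{v},\boldsymbol{\alpha})$ if $\{i:v_i\ne0\}\subseteq(a,a+l]$ and $\{i:\alpha_i\ne0\}\subseteq[a,a+l]$; $\emptyset$ is a span only of the zero cycle and $\mathbb{Z}_n$ of every cycle. $\mathbb{S}_{\mathfrak{s}}(T)$ is the subspace of cycles having span $\mathfrak{s}$ and $C_{\mathfrak{s}}(T):=L(\mathbb{S}_{\mathfrak{s}}(T))$. *)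

(* Defs.v *)
From HB Require Import structures.
From mathcomp Require Import all_boot all_order all_algebra all_field.
Set Implicit Arguments. Unset Strict Implicit. Unset Printing Implicit Defensive.
Import GRing.Theory.
Local Open Scope ring_scope.

(* Indices Z_n are represented by 'I_n (n >= 1); i+1 is ordS i. *)

Section Trellis.
Variables (F : finFieldType) (n : nat) (vT : vectType F).

Definition edgeT := ((vT * F^o) * vT)%type.
(* Cycle space: vertex families  x  label words. *)
Definition cycT := ({ffun 'I_n -> vT} * {ffun 'I_n -> F^o})%type.

Record trellis := Trellis {
  tV : 'I_n -> {vspace vT};
  tE : 'I_n -> {vspace edgeT}
}.

Variable T : trellis.

Definition trellis_wf : Prop :=
  forall i : 'I_n,
    (forall e : edgeT, e \in tE T i -> e.1.1 \in tV T i /\ e.2 \in tV T (ordS i))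
    /\ (forall v, v \in tV T i -> exists a w, ((v, a), w) \in tE T i)
    /\ (forall w, w \in tV T (ordS i) -> exists v a, ((v, a), w) \in tE T i).

Definition cyc_edge (i : 'I_n) (c : cycT) : edgeT := ((c.1 i, c.2 i), c.1 (ordS i)).

Definition cycles : {vspace cycT} :=
  (\bigcap_(i < n) (linfun (cyc_edge i) @^-1: tE T i))%VS.

Definition labL (c : cycT) : {ffun 'I_n -> F^o} := c.2.

Definition reduced : Prop :=
  forall (i : 'I_n) (e : edgeT), e \in tE T i ->
    exists2 c, c \in cycles & cyc_edge i c = e.

Definition one_to_one : Prop :=
  forall c1 c2, c1 \in cycles -> c2 \in cycles -> labL c1 = labL c2 -> c1 = c2.

End Trellis.

Arguments trellis : clear implicits.
Arguments cycT : clear implicits.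
Arguments edgeT : clear implicits.

Inductive trspan (n : nat) :=
| SpanEmpty
| SpanFull
| SpanNd of 'I_n & 'I_n.  (* (a, l) with 0 <= l <= n-1 *)

(* i \in [a, a+l]  (indices mod n) *)
Definition in_cspan n (a l i : 'I_n) : bool := (((i + n - a) %% n) <= l)%N.
(* i \in (a, a+l] = [a, a+l] \ {a} *)
Definition in_hspan n (a l i : 'I_n) : bool :=
  (0 < (i + n - a) %% n)%N && (((i + n - a) %% n) <= l)%N.

Section Spans.
Variables (F : finFieldType) (n : nat) (vT : vectType F).

Definition outside (a l : 'I_n) (c : cycT F n vT) : cycT F n vT :=
  ([ffun i => if in_hspan a l i then 0 else c.1 i],
   [ffun i => if in_cspan a l i then 0 else c.2 i]).

Definition cycles_span (T : trellis F n vT) (s : trspan n) : {vspace cycT F n vT} :=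
  match s with
  | SpanEmpty => 0%VS
  | SpanFull => cycles T
  | SpanNd a l => (cycles T :&: lker (linfun (outside a l)))%VS
  end.

Definition code_span (T : trellis F n vT) (s : trspan n) : {vspace {ffun 'I_n -> F^o}} :=
  (linfun (@labL F n vT) @: cycles_span T s)%VS.

End Spans.

Definition lin_iso (F : finFieldType) (n : nat) (vT vT' : vectType F)
  (T : trellis F n vT) (T' : trellis F n vT') : Prop :=
  exists f : 'I_n -> 'Hom(vT, vT'),
    forall i : 'I_n,
      [/\ (f i @: tV T i)%VS = tV T' i,
          {in tV T i &, injective (f i)} &
          forall v w (a : F^o), v \in tV T i -> w \in tV T (ordS i) ->
            (((v, a), w) \in tE T i) = (((f i v, a), f (ordS i) w) \in tE T' i)].

(* Main.v *)
Require Import Defs.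
From HB Require Import structures.
From mathcomp Require Import all_boot all_order all_algebra all_field zify.

(* A reduced trellis is recovered, up to linear isomorphism, from its cycle space
   S, the label map on S and the subspaces K_i of cycles through the zero vertex
   at time i: V_i is S / K_i, and E_i is the image of S.  So it suffices to build
   a label preserving linear bijection S(T) -> S(T') that maps each S_s(T) onto
   S_s(T'), since K_i is S_s for s = (i, n-1).  It is built by adding the spans s
   one at a time in the order of increasing length, and finally the span Z_n.
   At each stage the sum U of the S_t treated so far meets S_s exactly in
   S_(a,l-1) + S_(a+1,l-1), where s = (a,l): every cycle in an S_t vanishes at
   some vertex of (a,a+l] and can be cut there.  Hence the bijection carries
   U :&: S_s to its counterpart, and equality of dimensions and of codes allows
   it to be extended to U + S_s. *)

(** * Linear algebra: extending injective, label preserving maps *)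

Section LinearExtension.
Local Set Implicit Arguments.
Local Unset Strict Implicit.
Import GRing.Theory.
Local Open Scope ring_scope.
Variable K : fieldType.

Lemma capv_ker0P (V W : vectType K) (f : 'Hom(V, W)) (U : {vspace V}) :
  reflect (forall u, u \in U -> f u = 0 -> u = 0) ((U :&: lker f)%VS == 0%VS).
Proof.
apply: (iffP eqP) => [U0 u uU fu0 | U0].
  by apply/eqP; rewrite -memv0 -U0 memv_cap uU memv_ker fu0 eqxx.
apply/eqP; rewrite -subv0; apply/subvP=> u /memv_capP[uU].
by rewrite memv_ker memv0 => /eqP/(U0 _ uU)->.
Qed.

Lemma eq_in_limg (V W : vectType K) (f g : 'Hom(V, W))
    (U : {vspace V}) :
  {in U, f =1 g} -> (f @: U = g @: U)%VS.
Proof.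
move=> fg; apply/vspaceP=> w; apply/memv_imgP/memv_imgP => -[u uU ->].
  by exists u; rewrite ?fg.
by exists u; rewrite ?fg.
Qed.

(** [pi v = v - projv U v] kills [U] but not [x], so the coordinate of [pi v] along [pi x], times
    [y - f x], is a correction to [f] that vanishes on [U] and has the right value at [x]. *)
Lemma lfun_extend_vector (V W : vectType K) (f : 'Hom(V, W)) (U : {vspace V})
    (x : V) (y : W) :
  x \notin U -> exists2 g : 'Hom(V, W), {in U, g =1 f} & g x = y.
Proof.
move=> xU; pose pi v := v - projv U v.
pose t := [tuple pi x].
have pix : pi x != 0.
  by apply: contra xU; rewrite subr_eq0 => /eqP->; exact: memv_proj.
pose h v := coord t ord0 (pi v) *: (y - f x).
have hlin : linear h.
  move=> a u v; rewrite /h /pi linearP opprD addrACA -scalerBr linearP scalerDl.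
  by rewrite scalerA.
pose hL : {linear V -> W} := HB.pack h (GRing.isLinear.Build K V W _ h hlin).
exists (f + linfun hL) => [u uU|]; rewrite add_lfunE lfunE /= /h.
  by rewrite /pi projv_id // subrr linear0 scale0r addr0.
have /= -> := coord_free (X := t) ord0 ord0; last by rewrite seq1_free.
by rewrite scale1r addrC subrK.
Qed.

Variables (V V' Z : vectType K) (L : 'Hom(V, Z)) (L' : 'Hom(V', Z)).

(* A vector of [X] outside [U] is matched with one of [X'] outside [f U]: inside
   the kernels of the labels by counting dimensions, and, once [X :&: lker L]
   is contained in [U], with any vector having the same label. *)
Lemma matching_vector (X U : {vspace V}) (X' : {vspace V'}) (f : 'Hom(V, V')) :
    \dim X = \dim X' -> (L @: X = L' @: X')%VS ->
    (U :&: lker f = 0)%VS -> (f @: (U :&: X) = (f @: U) :&: X')%VS ->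
    {in U, forall u, L' (f u) = L u} -> ~~ (X <= U)%VS ->
  exists x y, [/\ x \in X, x \notin U, y \in X', y \notin (f @: U)%VS & L' y = L x].
Proof.
move=> dimX LX /eqP/capv_ker0P f0 fX Lf XU.
have dN : \dim (X :&: lker L) = \dim (X' :&: lker L').
  by apply/eqP; rewrite -(eqn_add2r (\dim (L @: X))) {2}LX !limg_ker_dim dimX.
case NU: (X :&: lker L <= U)%VS.
  have [x xX xU] := subvPn XU.
  have /memv_imgP[y yX' Lxy] : L x \in (L' @: X')%VS by rewrite -LX memv_img.
  exists x, y; split=> //; apply/negP => yU.
  have /memv_imgP[u /memv_capP[uU uX] yu] : y \in (f @: (U :&: X))%VS.
    by rewrite fX memv_cap yU.
  case/negP: xU; rewrite -(subrK u x) memvD //; apply: (subvP NU).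
  by rewrite memv_cap memvB //= memv_ker linearB /= Lxy yu Lf ?subrr.
have [x /memv_capP[xX xL] xU] := subvPn (negbT NU).
(* Otherwise [f] would map [X :&: lker L :&: U] onto a space containing [X' :&: lker L']; since the
   two label kernels have equal dimension, [X :&: lker L] would lie in [U]. *)
have /subvPn[y /memv_capP[yX' yL] yU] : ~~ (X' :&: lker L' <= f @: U)%VS.
  apply: contraFN NU => N'U.
  have sN : (X' :&: lker L' <= f @: (X :&: lker L :&: U))%VS.
    apply/subvP=> y yN'; have /memv_capP[yX' yL] := yN'.
    have /memv_imgP[u /memv_capP[uU uX] yu] : y \in (f @: (U :&: X))%VS.
      by rewrite fX memv_cap yX' (subvP N'U).
    apply/memv_imgP; exists u => //.
    by rewrite !memv_cap uX uU memv_ker -(Lf u uU) -yu -memv_ker yL.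
  have dle : (\dim (X :&: lker L) <= \dim (X :&: lker L :&: U))%N.
    rewrite dN; apply: leq_trans (dimvS sN) _.
    by rewrite -(limg_ker_dim f (_ :&: U)) leq_addl.
  by apply/capv_idPl/eqP; rewrite eqEdim capvSl.
exists x, y; split=> //.
by move: xL yL; rewrite !memv_ker => /eqP-> /eqP->.
Qed.

(** Induction on the codimension of [U :&: X] in [X]: each step adjoins a matched pair [x], [y] and
    sends [x] to [y]. Once [X] lies in [U], the third condition gives [f @: X <= X'], and
    injectivity with equal dimensions makes this an equality. *)
Lemma lfun_extend_space (X : {vspace V}) (X' : {vspace V'}) :
    \dim X = \dim X' -> (L @: X = L' @: X')%VS ->
  forall (U : {vspace V}) (f : 'Hom(V, V')),
    (U :&: lker f = 0)%VS -> (f @: (U :&: X) = (f @: U) :&: X')%VS ->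
    {in U, forall u, L' (f u) = L u} ->
  exists g : 'Hom(V, V'),
    [/\ {in U, g =1 f}, ((U + X) :&: lker g = 0)%VS,
        {in (U + X)%VS, forall v, L' (g v) = L v} & (g @: X = X')%VS].
Proof.
move=> dimX LX U f; have [m] := ubnP (\dim X - \dim (U :&: X)).
elim: m U f => // m IH U f; rewrite ltnS => le_m f0 fX Lf.
have [XU|XU] := boolP (X <= U)%VS.
  exists f; rewrite (addv_idPl XU); split=> //.
  rewrite (capv_idPr XU) in fX.
  have fX0 : (X :&: lker f = 0)%VS by apply/eqP; rewrite -subv0 -f0 capvS.
  by apply/eqP; rewrite eqEdim -dimX limg_dim_eq // fX capvSr /=.
have [x [y [xX xU yX' yU Lxy]]] := matching_vector dimX LX f0 fX Lf XU.
have [f1 f1U f1x] := lfun_extend_vector f y xU.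
have U1P v : v \in (U + <[x]>)%VS ->
    exists u k, [/\ u \in U, v = u + k *: x & f1 v = f u + k *: y].
  case/memv_addP=> u uU [_ /vlineP[k ->] ->]; exists u, k.
  by rewrite linearD linearZ /= f1U ?f1x.
have U1x : x \in (U + <[x]>)%VS by rewrite (subvP (addvSr _ _)) ?memv_line.
have UU1 u : u \in U -> u \in (U + <[x]>)%VS by apply/subvP/addvSl.
have [||||g [gU g0 Lg gX]] := IH (U + <[x]>)%VS f1.
- apply: leq_trans le_m; apply: ltn_sub2l.
    rewrite ltn_neqAle dimvS ?capvSr // andbT.
    apply: contra XU; rewrite (eq_leqif (dimv_leqif_eq (capvSr U X))).
    by move=> /eqP/capv_idPr.
  have sUU : (U :&: X <= (U + <[x]>) :&: X)%VS by rewrite capvS ?addvSl.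
  rewrite ltn_neqAle (dimvS sUU) andbT; apply: contra xU.
  rewrite (eq_leqif (dimv_leqif_eq sUU)) => /eqP E.
  by have : x \in (U :&: X)%VS; [rewrite E memv_cap U1x | case/memv_capP].
- apply/eqP/capv_ker0P=> v /U1P[u [k [uU -> ->]]].
  have [->|k0] := eqVneq k 0.
    by rewrite !scale0r !addr0; move/eqP/capv_ker0P: f0; apply.
  (* For [k] nonzero, [y] would be a multiple of [f u], hence in the image of [U]. *)
  move/eqP; rewrite addrC addr_eq0 => /eqP kyu; case/negP: yU.
  rewrite -[y](scalerK k0) kyu memvZ ?memvN ?memv_img //.
(* Since [x] is in [X] and [y] is in [X'], the terms [k *: x] and [k *: y] can be subtracted, which
   reduces both inclusions to the hypothesis on [U]. *)
- apply/vspaceP=> w; apply/idP/idP.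
    case/memv_imgP=> v /memv_capP[vU1 vX] ->; rewrite memv_cap memv_img //=.
    have [u [k [uU v_ ->]]] := U1P _ vU1; rewrite memvD ?memvZ //.
    have : f u \in (f @: (U :&: X))%VS.
      apply: memv_img; rewrite memv_cap uU /=.
      by rewrite -[u](addrK (k *: x)) -v_ memvB ?memvZ.
    by rewrite fX => /memv_capP[].
  case/memv_capP=> /memv_imgP[v /U1P[u [k [uU -> fv]]] ->]; rewrite fv => wX'.
  have /memv_imgP[u2 /memv_capP[u2U u2X] ->] : f u \in (f @: (U :&: X))%VS.
    by rewrite fX memv_cap memv_img //= -[f u](addrK (k *: y)) memvB ?memvZ.
  apply/memv_imgP; exists (u2 + k *: x); last by rewrite linearD linearZ /= f1U ?f1x.
  by rewrite memv_cap !memvD ?memvZ ?(UU1 _ u2U).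
- by move=> v /U1P[u [k [uU -> ->]]]; rewrite !linearD !linearZ /= Lf ?Lxy.
have E : (U + <[x]> + X = U + X)%VS.
  by rewrite -addvA; congr (_ + _)%VS; apply/addv_idPr; rewrite -memvE.
by exists g; rewrite -E; split=> // u uU; rewrite gU ?UU1 ?f1U.
Qed.

End LinearExtension.

(** * Arithmetic of positions on the cycle of indices *)

Section CyclicPosition.
Local Set Implicit Arguments.
Local Unset Strict Implicit.
Variable n : nat.
Implicit Types a b i j : 'I_n.

(** The number of forward steps from [a] to [i]. It is the very expression in [in_cspan] and
    [in_hspan], so span membership unfolds to inequalities on [cpos]. *)
Definition cpos a i : nat := (i + n - a) %% n.

Lemma cposE a i : cpos a i = if a <= i then i - a else i + n - a.
Proof.
have [ltan ltin] := (ltn_ord a, ltn_ord i); rewrite /cpos; case: leqP => ai.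
  by rewrite addnC -addnBA // modnDl modn_small //; lia.
by rewrite modn_small //; lia.
Qed.

Lemma ordSE i : ordS i = (if i.+1 == n then 0 else i.+1) :> nat.
Proof.
have ltin := ltn_ord i; rewrite /=; case: eqP => [->|ne]; first exact: modnn.
by rewrite modn_small //; lia.
Qed.

Lemma cpos_lt a i : cpos a i < n.
Proof.
have [ltan ltin] := (ltn_ord a, ltn_ord i).
by rewrite cposE; case: (leqP a i); lia.
Qed.

Lemma cpos_id a : cpos a a = 0.
Proof. by rewrite cposE leqnn subnn. Qed.

Lemma cpos_inj a : injective (cpos a).
Proof.
move=> i j; have [ltan ltin ltjn] := And3 (ltn_ord a) (ltn_ord i) (ltn_ord j).
by rewrite !cposE => ij; apply: val_inj => /=; move: ij; do 2!case: leqP => ?; lia.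
Qed.

Lemma cpos_eq0 a i : cpos a i = 0 -> i = a.
Proof. by move=> ai; apply: (@cpos_inj a); rewrite cpos_id. Qed.

Lemma cposS a i : cpos a (ordS i) = if (cpos a i).+1 == n then 0 else (cpos a i).+1.
Proof.
have [ltan ltin] := (ltn_ord a, ltn_ord i); rewrite !cposE ordSE.
by case: (_.+1 =P n) => ?; do ![case: leqP => ? | case: eqP => ?]; lia.
Qed.

Lemma cposSl a i : cpos (ordS a) i = if cpos a i == 0 then n.-1 else (cpos a i).-1.
Proof.
have [ltan ltin] := (ltn_ord a, ltn_ord i); rewrite !cposE ordSE.
by case: (_.+1 =P n) => ?; do ![case: leqP => ? | case: eqP => ?]; lia.
Qed.

Lemma cpos_surj a p : p < n -> exists i, cpos a i = p.
Proof.
move=> ltpn; have ltan := ltn_ord a.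
have lt : (if a + p < n then a + p else a + p - n) < n by case: (ltnP (a + p)); lia.
by exists (Ordinal lt); rewrite cposE /=; case: (ltnP (a + p)) => ?; case: leqP => ?; lia.
Qed.

Lemma cpos_change a b i :
  cpos b i = if cpos a b <= cpos a i then cpos a i - cpos a b
             else cpos a i + n - cpos a b.
Proof.
have [ltan ltin ltbn] := And3 (ltn_ord a) (ltn_ord i) (ltn_ord b).
rewrite !cposE; case: (leqP a b) => ?; case: (leqP a i) => ?.
all: by do !case: leqP => ?; lia.
Qed.

End CyclicPosition.

(** * Cycles with prescribed span, and how they are cut *)

Section Cycles.
Local Set Implicit Arguments.
Local Unset Strict Implicit.
Import GRing.Theory.
Local Open Scope ring_scope.
Variables (F : finFieldType) (n : nat) (vT : vectType F).
Implicit Types (T : trellis F n vT) (c : cycT F n vT) (a l i j : 'I_n).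

Definition cyc_vertex i c : vT := c.1 i.

Fact cyc_vertex_is_linear i : linear (cyc_vertex i).
Proof. by move=> k c d; rewrite /cyc_vertex /= !ffunE. Qed.
HB.instance Definition _ i :=
  GRing.isLinear.Build F (cycT F n vT) vT _ (cyc_vertex i) (cyc_vertex_is_linear i).

Fact cyc_edge_is_linear i : linear (@cyc_edge F n vT i).
Proof. by move=> k c d; rewrite /cyc_edge /= !ffunE. Qed.
HB.instance Definition _ i :=
  GRing.isLinear.Build F (cycT F n vT) (edgeT F vT) _ (@cyc_edge F n vT i)
    (cyc_edge_is_linear i).

Fact labL_is_linear : linear (@labL F n vT).
Proof. by []. Qed.
HB.instance Definition _ :=
  GRing.isLinear.Build F (cycT F n vT) {ffun 'I_n -> F^o} _ (@labL F n vT)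
    labL_is_linear.

Fact outside_is_linear a l : linear (@outside F n vT a l).
Proof.
move=> k c d; congr pair; apply/ffunP=> i; rewrite !ffunE /=.
  by case: ifP; rewrite ?scaler0 ?addr0.
by case: ifP; rewrite ?scaler0 ?addr0.
Qed.
HB.instance Definition _ a l :=
  GRing.isLinear.Build F (cycT F n vT) (cycT F n vT) _ (@outside F n vT a l)
    (outside_is_linear a l).

Lemma cyclesP T c :
  reflect (forall i, cyc_edge i c \in tE T i) (c \in cycles T).
Proof.
rewrite memvE; apply: (iffP subv_bigcapP) => cE i.
  by have := cE i isT; rewrite -memvE -memv_preim lfunE.
by move=> _; rewrite -memvE -memv_preim lfunE; apply: cE.
Qed.

Lemma cycles_spanNdP T a l c :
  reflect [/\ c \in cycles T,
              forall i, ~~ (0 < cpos a i <= l)%N -> c.1 i = 0 &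
              forall i, ~~ (cpos a i <= l)%N -> c.2 i = 0]
          (c \in cycles_span T (SpanNd a l)).
Proof.
apply: (iffP memv_capP) => [[cT]|[cT c1 c2]].
  rewrite memv_ker lfunE => /eqP[/ffunP c1 /ffunP c2]; split=> // i /negPf ai.
    by have := c1 i; rewrite !ffunE /in_hspan ai.
  by have := c2 i; rewrite !ffunE /in_cspan ai.
split=> //; rewrite memv_ker lfunE; apply/eqP; congr pair; apply/ffunP=> i; rewrite !ffunE.
  by case: ifPn => // /c1.
by case: ifPn => // /c2.
Qed.

Lemma cycles_span_sub T s : (cycles_span T s <= cycles T)%VS.
Proof. by case: s => [||a l] /=; rewrite ?sub0v ?capvSl. Qed.

Definition cycles_through0 T i : {vspace cycT F n vT} :=
  (cycles T :&: lker (linfun (cyc_vertex i)))%VS.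

Lemma cycles_through0P T i c :
  reflect (c \in cycles T /\ c.1 i = 0) (c \in cycles_through0 T i).
Proof.
by apply: (iffP memv_capP); rewrite memv_ker lfunE => -[cT /eqP].
Qed.

(** For length [n - 1], the half-open interval omits only [i] and the closed one omits nothing, so
    the sole condition left is at vertex [i]. *)
Lemma cycles_through0E T i l : l.+1 = n ->
  cycles_through0 T i = cycles_span T (SpanNd i l).
Proof.
move=> ln; have le_l j : (cpos i j <= l)%N by rewrite -ltnS ln cpos_lt.
apply/vspaceP=> c; apply/cycles_through0P/cycles_spanNdP => -[cT c0].
  split=> // j; last by rewrite le_l.
  by rewrite le_l andbT -eqn0Ngt => /eqP/cpos_eq0->.
by move=> _; split=> //; apply: c0; rewrite cpos_id.
Qed.

(** Keeps the first [p] positions counted from [a]; the result need not be a cycle, as it may break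
    at [a] and at the cut. *)
Definition cyc_trunc a (p : nat) c : cycT F n vT :=
  ([ffun i => if (cpos a i < p)%N then c.1 i else 0],
   [ffun i => if (cpos a i < p)%N then c.2 i else 0]).

Lemma sum_cycle1 (I : finType) (P : pred I) (x : I -> cycT F n vT) i :
  (\sum_(k | P k) x k).1 i = \sum_(k | P k) (x k).1 i.
Proof. exact: (linear_sum (cyc_vertex i)). Qed.

Lemma sum_cycle2 (I : finType) (P : pred I) (x : I -> cycT F n vT) i :
  (\sum_(k | P k) x k).2 i = \sum_(k | P k) (x k).2 i.
Proof.
by rewrite -[LHS]/(labL _ i) linear_sum sum_ffunE.
Qed.

(* Cutting the summand that vanishes at vertex [i] at that vertex leaves its part
   before [i].  These initial parts add up to a cycle since the initial vertices
   add up to the vertex [a] of the whole, which is zero. *)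
Lemma cycles_span_split T a l l' : (0 < l)%N -> l.-1 = l' ->
  (cycles_span T (SpanNd a l)
     :&: \sum_(i | (0 < cpos a i <= l)%N) cycles_through0 T i
   <= cycles_span T (SpanNd a l') + cycles_span T (SpanNd (ordS a) l'))%VS.
Proof.
move=> l_gt0 def_l'; apply/subvP=> c /memv_capP[/cycles_spanNdP[cT c1 c2]].
case/memv_sumP=> x xP def_c.
have ltln := ltn_ord l.
have {}xP i : (0 < cpos a i <= l)%N -> x i \in cycles T /\ (x i).1 i = 0.
  by move/xP/cycles_through0P.
pose t i := cyc_trunc a (cpos a i) (x i).
pose d := \sum_(i | (0 < cpos a i <= l)%N) t i.
have d_a : d.1 a = 0.
  transitivity (c.1 a); last by apply: c1; rewrite cpos_id.
  rewrite def_c !sum_cycle1.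
  by apply: eq_bigr => i /andP[i0 _]; rewrite ffunE cpos_id i0.
have d1 i : ~~ (0 < cpos a i <= l')%N -> d.1 i = 0.
  have [/cpos_eq0-> _ //|] := posnP (cpos a i).
  rewrite /= -ltnNge => i0 l'i; rewrite sum_cycle1 big1 // => j /andP[j0 jl].
  by rewrite ffunE ifF //; lia.
have d2 i : ~~ (cpos a i <= l')%N -> d.2 i = 0.
  rewrite -ltnNge => l'i; rewrite sum_cycle2 big1 // => j /andP[j0 jl].
  by rewrite ffunE ifF //; lia.
have dT : d \in cycles T.
  apply/cyclesP=> j; have [jn|jn] := eqVneq (cpos a j).+1 n.
    (* The edge closing up at [a] is zero: [j] has position [n - 1], beyond [l'], and [d] vanishes
       at [a]. *)
    have Sj : ordS j = a by apply: (@cpos_eq0 n a); rewrite cposS jn eqxx.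
    rewrite /cyc_edge Sj d_a d1 ?d2 ?mem0v //; lia.
  have Sj : cpos a (ordS j) = (cpos a j).+1 by rewrite cposS (negPf jn).
  rewrite linear_sum memv_suml // => i il; have [xT xi0] := xP i il.
  (* Before the cut at [i] the truncation has the edge of [x i], also when it ends at [i], where
     [x i] is zero anyway; from [i] on its edge is zero. *)
  rewrite /= /cyc_edge !ffunE Sj; case: (ltngtP (cpos a j) (cpos a i)) => ji /=.
  - have -> : (if ((cpos a j).+1 < cpos a i)%N then (x i).1 (ordS j) else 0)
             = (x i).1 (ordS j).
      case: ltnP => // ij; have -> // : ordS j = i.
      by apply: (@cpos_inj n a); lia.
    by move/cyclesP: xT; apply.
  - by rewrite ifF ?mem0v //; lia.
  - by rewrite ifF ?mem0v //; lia.
apply/memv_addP; exists d; first exact/cycles_spanNdP.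
(* The remainder starts one index later: no cut is at [a], so [c] and [d] share the label at [a].
   They also agree at vertex [a+1], since a summand cut there already vanishes there. *)
exists (c - d); last by rewrite addrC subrK.
apply/cycles_spanNdP; split; first exact: memvB.
- move=> i; rewrite cposSl => iP.
  suff cd : c.1 i = d.1 i by rewrite /= !ffunE /= cd subrr.
  have [ai|ai] := eqVneq (cpos a i) 0%N.
    by rewrite c1 ?d1 ?ai.
  rewrite (negPf ai) in iP.
  have [ai1|ai1] := eqVneq (cpos a i) 1%N; last by rewrite c1 ?d1 //; lia.
  rewrite def_c !sum_cycle1; apply: eq_bigr => j jl; have [_ xj] := xP j jl.
  rewrite ffunE ai1; case: ltnP => // j1.
  by have -> : i = j; [apply: (@cpos_inj n a); lia | ].
- move=> i; rewrite cposSl => iP.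
  suff cd : c.2 i = d.2 i by rewrite /= !ffunE /= cd subrr.
  have [ai|ai] := eqVneq (cpos a i) 0%N; last first.
    by rewrite (negPf ai) in iP; rewrite c2 ?d2 //; lia.
  rewrite def_c !sum_cycle2; apply: eq_bigr => j /andP[j0 _].
  by rewrite ffunE ai j0.
Qed.

(* Orders the spans by length first, so that proper subspans come earlier. *)
Definition span_rank (t : 'I_n * 'I_n) : nat := t.2 * n + t.1.

Definition ranked_sum T k : {vspace cycT F n vT} :=
  (\sum_(t : 'I_n * 'I_n | (span_rank t < k)%N) cycles_span T (SpanNd t.1 t.2))%VS.

Lemma span_rank_lt a l b m :
  (span_rank (b, m) < span_rank (a, l))%N = (m < l)%N || (m == l :> nat) && (b < a)%N.
Proof.
have [ltan ltbn] := (ltn_ord a, ltn_ord b); rewrite /span_rank /=.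
have [ml|lm|->] := ltngtP m l.
- have : (m.+1 * n <= l * n)%N by rewrite leq_mul2r ml orbT.
  by rewrite mulSn; lia.
- have : (l.+1 * n <= m * n)%N by rewrite leq_mul2r lm orbT.
  by rewrite mulSn; lia.
- by rewrite /= ltn_add2l.
Qed.

(** A cycle of span [(a, 0)] can be nonzero only in its label at [a]. The earlier spans are the
    [(b, 0)] with [b < a], whose cycles have label zero at [a]. *)
Lemma cycles_span_cap0 T a l : l = 0%N :> nat ->
  (ranked_sum T (span_rank (a, l)) :&: cycles_span T (SpanNd a l) = 0)%VS.
Proof.
move=> l0; apply/eqP; rewrite -subv0; apply/subvP=> c.
case/memv_capP=> /memv_sumP[x xP def_c] /cycles_spanNdP[_ c1 c2].
rewrite memv0; apply/eqP; rewrite [c]surjective_pairing.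
congr pair; apply/ffunP=> i; rewrite ffunE; first by apply: c1; lia.
have [/cpos_eq0->|ai] := posnP (cpos a i); last by apply: c2; lia.
rewrite def_c sum_cycle2 big1 // => -[b m] /=.
move=> bm; have := xP _ bm; move: bm; rewrite span_rank_lt l0 /= => bm.
have ltba : (b < a)%N by lia.
case/cycles_spanNdP=> _ _; apply; apply/negP=> bam.
suff ab : a = b by rewrite ab ltnn in ltba.
by apply: (@cpos_eq0 n b); lia.
Qed.

Lemma cycles_span_cap T a l l' : (0 < l)%N -> l.-1 = l' ->
  (ranked_sum T (span_rank (a, l)) :&: cycles_span T (SpanNd a l)
   = cycles_span T (SpanNd a l') + cycles_span T (SpanNd (ordS a) l'))%VS.
Proof.
move=> l_gt0 def_l'; have [ltln ltan] := (ltn_ord l, ltn_ord a).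
apply/eqP; rewrite eqEsubv; apply/andP; split.
  apply: subv_trans (cycles_span_split T a l_gt0 def_l').
  rewrite capvC capvS //; apply/subv_sumP=> -[b m]; rewrite span_rank_lt => bm.
  (* A vertex of [(a, a+l]] where cycles of span [(b, m)] vanish: [b] itself if it lies there,
     otherwise the endpoint [a+l]. The endpoint works because for [b = a] the rank forces [m < l],
     and for [b] outside [[a, a+l]] it is more than [l >= m] steps from [b]. *)
  have [i [il bi]] : exists i, (0 < cpos a i <= l)%N /\ ~~ (0 < cpos b i <= m)%N.
    have [bl|bl] := boolP (0 < cpos a b <= l)%N; first by exists b; rewrite cpos_id.
    have [i ai] := cpos_surj a ltln; exists i; rewrite ai l_gt0 leqnn; split=> //.
    rewrite (cpos_change a) ai; have := cpos_lt a b.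
    have [/cpos_eq0 ba|] := posnP (cpos a b).
      rewrite ba cpos_id leq0n subn0; move: bm; rewrite ba ltnn andbF orbF; lia.
    by case: (leqP _ l); lia.
  apply: (sumv_sup i) => //; apply/subvP=> c /cycles_spanNdP[cT c1 _].
  by apply/cycles_through0P; split; [| apply: c1].
(* Conversely, both spans of length [l - 1] lie inside [(a, l)] and have smaller rank. *)
have sub_l b : (forall i, 0 < cpos b i <= l' -> 0 < cpos a i <= l)%N ->
    (forall i, cpos b i <= l' -> cpos a i <= l)%N ->
    (cycles_span T (SpanNd b l') <=
     ranked_sum T (span_rank (a, l)) :&: cycles_span T (SpanNd a l))%VS.
  move=> h1 h2; rewrite subv_cap; apply/andP; split.
    by apply: (sumv_sup (b, l')) => //; rewrite span_rank_lt; apply/orP; left; lia.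
  apply/subvP=> c /cycles_spanNdP[cT c1 c2]; apply/cycles_spanNdP; split=> // i.
    by move=> ai; apply: c1; apply: contra ai; apply: h1.
  by move=> ai; apply: c2; apply: contra ai; apply: h2.
rewrite subv_add !sub_l // => i; rewrite ?cposSl; [case: eqP | case: eqP | |]; lia.
Qed.

End Cycles.

(** * From equal span data to a linear isomorphism *)

Section Isomorphism.
Local Set Implicit Arguments.
Local Unset Strict Implicit.
Import GRing.Theory.
Local Open Scope ring_scope.
Variables (F : finFieldType) (n : nat) (vT vT' : vectType F).
Variables (T : trellis F n vT) (T' : trellis F n vT').
Hypothesis n_gt0 : (0 < n)%N.

Lemma span_rank_inj : injective (@span_rank n).
Proof.
move=> [a l] [b m] E; have := span_rank_lt a l b m; have := span_rank_lt b m a l.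
by rewrite E ltnn => h1 h2; congr pair; apply: val_inj => /=; lia.
Qed.

Lemma span_rank_surj k : (k < n * n)%N -> exists t : 'I_n * 'I_n, span_rank t = k.
Proof.
move=> lt_k; have lt1 : (k %% n < n)%N by rewrite ltn_mod.
have lt2 : (k %/ n < n)%N by rewrite ltn_divLR.
by exists (Ordinal lt1, Ordinal lt2); rewrite /span_rank /= -divn_eq.
Qed.

Lemma span_rank_max (t : 'I_n * 'I_n) : (span_rank t < n * n)%N.
Proof.
case: t => a l; have [ltan ltln] := (ltn_ord a, ltn_ord l); rewrite /span_rank /=.
have : (l.+1 * n <= n * n)%N by rewrite leq_mul2r ltln orbT.
by rewrite mulSn; lia.
Qed.

Hypothesis eq_spans : forall s : trspan n,
  \dim (cycles_span T s) = \dim (cycles_span T' s) /\ code_span T s = code_span T' s.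

Lemma ranked_isomorphism k : (k <= n * n)%N ->
  exists f : 'Hom(cycT F n vT, cycT F n vT'),
    [/\ (ranked_sum T k :&: lker f = 0)%VS,
        {in ranked_sum T k, forall c, labL (f c) = labL c} &
        forall a l, (span_rank (a, l) < k)%N ->
          (f @: cycles_span T (SpanNd a l) = cycles_span T' (SpanNd a l))%VS].
Proof.
elim: k => [_|k IH lt_k].
  exists 0; rewrite /ranked_sum big_pred0 ?cap0v //; split=> // c.
  by rewrite memv0 => /eqP->; rewrite lfunE.
have [[a l] def_k] := span_rank_surj lt_k.
have [f [f0 Lf fS]] := IH (ltnW lt_k).
have fU : (f @: ranked_sum T k = ranked_sum T' k)%VS.
  by rewrite limg_sum; apply: eq_bigr => -[b m]; apply: fS.
(* Both intersections are zero for length 0, and otherwise sums of two shorter span spaces, which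
   [f] already matches. *)
have fX : (f @: (ranked_sum T k :&: cycles_span T (SpanNd a l))
           = (f @: ranked_sum T k) :&: cycles_span T' (SpanNd a l))%VS.
  rewrite fU -def_k; have [l0|l_gt0] := posnP l.
    by rewrite !cycles_span_cap0 // limg0.
  have lt_l' : (l.-1 < n)%N by have := ltn_ord l; lia.
  rewrite !(@cycles_span_cap _ _ _ _ a l (Ordinal lt_l')) // limgD.
  by rewrite !fS // -def_k span_rank_lt; apply/orP; left => /=; lia.
have [dimX LX] := eq_spans (SpanNd a l).
have [|g [gU g0 Lg gX]] := lfun_extend_space dimX LX f0 fX.
  by move=> c cU; rewrite !lfunE /= Lf.
have rankP b m : (span_rank (b, m) < k.+1)%N ->
    (span_rank (b, m) < k)%N \/ (b, m) = (a, l).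
  rewrite ltnS leq_eqVlt => /orP[/eqP bm|]; last by left.
  by right; apply: span_rank_inj; rewrite bm.
have sU : (ranked_sum T k.+1 <= ranked_sum T k + cycles_span T (SpanNd a l))%VS.
  apply/subv_sumP=> -[b m] /rankP[bm | [-> ->]]; last exact: addvSr.
  by apply: subv_trans (addvSl _ _); apply: (sumv_sup (b, m)).
exists g; split.
- by apply/eqP; rewrite -subv0 -g0 capvS.
- by move=> c /(subvP sU)/Lg; rewrite !lfunE.
move=> b m /rankP[bm | [-> ->] //]; rewrite -fS //; apply: eq_in_limg => c cS.
by apply: gU; apply: subvP cS; apply: (sumv_sup (b, m)).
Qed.

Lemma cycles_isomorphism :
  exists f : 'Hom(cycT F n vT, cycT F n vT'),
    [/\ forall c, c \in cycles T -> f c = 0 -> c = 0,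
        {in cycles T, forall c, labL (f c) = labL c},
        (f @: cycles T = cycles T')%VS &
        forall i, (f @: cycles_through0 T i = cycles_through0 T' i)%VS].
Proof.
have [f [f0 Lf fS]] := ranked_isomorphism (leqnn _).
have sU m (vU : vectType F) (R : trellis F m vU) k : (ranked_sum R k <= cycles R)%VS.
  by apply/subv_sumP=> t _; apply: cycles_span_sub.
have fU : (f @: ranked_sum T (n * n) = ranked_sum T' (n * n))%VS.
  by rewrite limg_sum; apply: eq_bigr => -[b m]; apply: fS.
have [/= dimX LX] := eq_spans (SpanFull n).
have [||g [gU g0 Lg gX]] := lfun_extend_space dimX LX f0.
(* For the span [Z_n] compatibility is automatic, as all span spaces lie in the cycle space. *)
- by rewrite fU !(capv_idPl (sU _ _ _ _)).
- by move=> c cU; rewrite !lfunE /= Lf.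
rewrite (addv_idPr (sU _ _ _ _)) in g0 Lg.
exists g; split=> //; first exact/capv_ker0P/eqP.
  by move=> c /Lg; rewrite !lfunE.
move=> i; have ltn1 : (n.-1 < n)%N by rewrite prednK.
rewrite !(@cycles_through0E _ _ _ _ i (Ordinal ltn1)) ?prednK //.
rewrite -fS ?span_rank_max //; apply: eq_in_limg => c cS.
by apply: gU; apply: subvP cS; apply: (sumv_sup (i, Ordinal ltn1)); rewrite // span_rank_max.
Qed.

Lemma cycle_vertex_mem (vU : vectType F) (R : trellis F n vU) c i :
  trellis_wf R -> c \in cycles R -> c.1 i \in tV R i.
Proof. by move=> wfR /cyclesP/(_ i) cE; have [h _] := wfR i; have [] := h _ cE. Qed.

Lemma vertex_on_cycle (vU : vectType F) (R : trellis F n vU) i v :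
  trellis_wf R -> reduced R -> v \in tV R i ->
  exists2 c, c \in cycles R & c.1 i = v.
Proof.
move=> wfR redR vV; have [_ [h _]] := wfR i; have [a [w vE]] := h v vV.
by have [c cR []] := redR i _ vE; exists c.
Qed.

(** The vertex maps are defined by sending [c.1 i] to [(g c).1 i]; this is well defined and
    injective because [g] maps the cycles vanishing at [i] exactly onto their counterparts. *)
Lemma lin_iso_of_eq_spans :
  trellis_wf T -> trellis_wf T' -> reduced T -> reduced T' -> lin_iso T T'.
Proof.
move=> wfT wfT' redT redT'; have [g [g0 Lg gS gK]] := cycles_isomorphism.
have f_ex i : exists f : 'Hom(vT, vT'),
    forall c, c \in cycles T -> f (c.1 i) = (g c).1 i.
  pose r := (linfun (@cyc_vertex F n vT i) \o projv (cycles T))%VF.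
  (* A linear choice of a cycle through a given vertex: [r^-1] picks some preimage under [r], and
     [projv] turns it into a cycle [d] with the same vertex at [i]. *)
  exists (linfun (@cyc_vertex F n vT' i) \o g \o projv (cycles T) \o r^-1)%VF => c cT.
  rewrite !comp_lfunE lfunE /= /cyc_vertex.
  set d := projv _ _; have dT : d \in cycles T by apply: memv_proj.
  have cV : c.1 i \in limg r.
    apply/memv_imgP; exists c; first exact: memvf.
    by rewrite comp_lfunE projv_id // lfunE.
  have d_i : d.1 i = c.1 i.
    by have := limg_lfunVK cV; rewrite {1}/r comp_lfunE lfunE.
  have : g (d - c) \in cycles_through0 T' i.
    rewrite -gK memv_img //; apply/cycles_through0P; split; first exact: memvB.
    by rewrite /= !ffunE d_i subrr.
  case/cycles_through0P=> _; rewrite linearB /= !ffunE => /eqP.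
  by rewrite subr_eq0 => /eqP.
have [f fP] := fin_all_exists f_ex.
have gT c : c \in cycles T -> g c \in cycles T' by move=> cT; rewrite -gS memv_img.
have f0 i v : v \in tV T i -> f i v = 0 -> v = 0.
  case/(vertex_on_cycle wfT redT)=> c cT <-; rewrite fP // => gc0.
  have : g c \in cycles_through0 T' i by apply/cycles_through0P; split; rewrite ?gT.
  rewrite -gK => /memv_imgP[d /cycles_through0P[dT d0] gcd].
  suff -> : c = d by [].
  apply/eqP; rewrite -subr_eq0; apply/eqP; apply: g0; first exact: memvB.
  by rewrite linearB /= gcd subrr.
have f_inj i : {in tV T i &, injective (f i)}.
  move=> u v uV vV fuv; apply/eqP; rewrite -subr_eq0; apply/eqP; apply: (f0 i).
    exact: memvB.
  by rewrite linearB /= fuv subrr.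
exists f => i; split=> // [|v w a vV wV].
  apply/vspaceP=> w; apply/memv_imgP/idP => [[v vV ->] | wV].
    have [c cT <-] := vertex_on_cycle wfT redT vV.
    by rewrite fP // cycle_vertex_mem ?gT.
  have [c' cT' <-] := vertex_on_cycle wfT' redT' wV.
  move: cT'; rewrite -gS => /memv_imgP[c cT ->].
  by exists (c.1 i); rewrite ?cycle_vertex_mem ?fP.
(* Reducedness puts the edge on a cycle, which [g] transports; in the backward direction injectivity
   of the vertex maps identifies the endpoints with [v] and [w]. *)
apply/idP/idP => [/redT[c cT [<- <- <-]] | /redT'[c']].
  have /cyclesP/(_ i) := gT c cT; rewrite /cyc_edge !fP //.
  by rewrite -[(g c).2]/(labL _) Lg.
rewrite -gS => /memv_imgP[c cT ->] [].
rewrite -!fP // -[(g c).2]/(labL _) Lg // => /f_inj cv <- /f_inj cw.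
rewrite -cv ?cycle_vertex_mem // -cw ?cycle_vertex_mem //.
by move/cyclesP: cT; apply.
Qed.

End Isomorphism.

(** * Isomorphic trellises have equal span data *)

Section Invariants.
Local Set Implicit Arguments.
Local Unset Strict Implicit.
Import GRing.Theory.
Local Open Scope ring_scope.
Variables (F : finFieldType) (n : nat) (vT vT' : vectType F).
Variables (T : trellis F n vT) (T' : trellis F n vT').

Definition cyc_map (f : 'I_n -> 'Hom(vT, vT')) (c : cycT F n vT) : cycT F n vT' :=
  ([ffun i => f i (c.1 i)], c.2).

Fact cyc_map_is_linear f : linear (cyc_map f).
Proof.
by move=> k c d; congr pair; apply/ffunP=> i; rewrite !ffunE /= linearP.
Qed.
HB.instance Definition _ f :=
  GRing.isLinear.Build F (cycT F n vT) (cycT F n vT') _ (cyc_map f)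
    (cyc_map_is_linear f).

(** Applying the isomorphism vertex by vertex gives a bijection of cycles that keeps labels and the
    set of nonzero vertices, hence all spans. *)
Lemma lin_iso_eq_spans (s : trspan n) :
    trellis_wf T -> trellis_wf T' -> lin_iso T T' ->
  \dim (cycles_span T s) = \dim (cycles_span T' s) /\ code_span T s = code_span T' s.
Proof.
move=> wfT wfT' [f fP].
have fV i v : v \in tV T i -> f i v \in tV T' i.
  by have [<- _ _] := fP i; apply: memv_img.
have f0 i v : v \in tV T i -> f i v = 0 -> v = 0.
  have [_ f_inj _] := fP i; move=> vV fv0; apply: (f_inj) => //; first exact: mem0v.
  by rewrite fv0 linear0.
have mapT c : c \in cycles T -> cyc_map f c \in cycles T'.
  move=> cT; apply/cyclesP=> i; have [_ _ h] := fP i.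
  rewrite /cyc_edge /= !ffunE -h ?cycle_vertex_mem //.
  by move/cyclesP: cT; apply.
have im_s : (linfun (cyc_map f) @: cycles_span T s = cycles_span T' s)%VS.
  (* Preimages of the vertices are chosen independently; they form a cycle because the edge
     condition is an equivalence. *)
  have liftT c' : c' \in cycles T' ->
      exists2 c, c \in cycles T & c' = cyc_map f c.
    move=> cT'; have v_ex i : exists v, v \in tV T i /\ f i v = c'.1 i.
      have [fVi _ _] := fP i.
      have := cycle_vertex_mem i wfT' cT'; rewrite -fVi => /memv_imgP[v vV ->].
      by exists v.
    have [v vP] := fin_all_exists v_ex.
    exists ([ffun i => v i], c'.2).
      apply/cyclesP=> i; have [_ _ h] := fP i.
      have [[viV fvi] [vjV fvj]] := (vP i, vP (ordS i)).
      rewrite /cyc_edge /= !ffunE h // fvi fvj.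
      by move/cyclesP: cT'; apply.
    rewrite [LHS]surjective_pairing; congr pair; apply/ffunP=> i.
    by rewrite !ffunE /=; have [_ ->] := vP i.
  case: s => [||a l]; first by rewrite limg0.
    apply/vspaceP=> c'; apply/memv_imgP/idP => [[c cT ->] | /liftT[c cT ->]].
      by rewrite lfunE mapT.
    by exists c; rewrite ?lfunE.
  apply/vspaceP=> c'; apply/memv_imgP/cycles_spanNdP.
    case=> c /cycles_spanNdP[cT c1 c2] ->; rewrite lfunE; split=> //.
      exact: mapT.
    by move=> i /c1 ci0; rewrite ffunE ci0 linear0.
  case=> /liftT[c cT ->] c1 c2; exists c; last by rewrite lfunE.
  apply/cycles_spanNdP; split=> // i /c1; rewrite ffunE; apply: f0.
  exact: cycle_vertex_mem.
split.
  rewrite -im_s limg_dim_eq //; apply/eqP/capv_ker0P => c.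
  move/(subvP (cycles_span_sub _ _)) => cT.
  rewrite lfunE => -[/ffunP c1 c2]; rewrite [c]surjective_pairing c2.
  congr pair; apply/ffunP=> i; rewrite ffunE; apply: (f0 i).
    exact: cycle_vertex_mem.
  by have := c1 i; rewrite !ffunE.
rewrite /code_span -im_s -limg_comp; apply: eq_in_limg => c _.
by rewrite comp_lfunE !lfunE.
Qed.

(** This makes the dimension condition a consequence of equality of the codes. *)
Lemma one_to_one_dim (s : trspan n) :
  one_to_one T -> \dim (cycles_span T s) = \dim (code_span T s).
Proof.
move=> inj; rewrite limg_dim_eq //; apply/eqP/capv_ker0P => c.
move/(subvP (cycles_span_sub _ _)) => cT.
by rewrite lfunE => Lc0; apply: inj; rewrite ?mem0v.
Qed.

End Invariants.

Theorem mainTheorem5 (F : finFieldType) (n : nat) (n_gt0 : (0 < n)%N)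
  (vT vT' : vectType F) (T : trellis F n vT) (T' : trellis F n vT') :
  trellis_wf T -> trellis_wf T' -> reduced T -> reduced T' ->
  (lin_iso T T' <->
     (forall s : trspan n,
        \dim (cycles_span T s) = \dim (cycles_span T' s) /\
        code_span T s = code_span T' s))
  /\ (one_to_one T -> one_to_one T' ->
      (lin_iso T T' <-> forall s : trspan n, code_span T s = code_span T' s)).
Proof.
move=> wfT wfT' redT redT'; split.
  split=> [iso s | eqs]; first exact: lin_iso_eq_spans.
  exact: lin_iso_of_eq_spans.
move=> inj inj'; split=> [iso s | eqs]; first by have [] := lin_iso_eq_spans s wfT wfT' iso.
apply: lin_iso_of_eq_spans => // s; split=> //.
by rewrite (one_to_one_dim s inj) (one_to_one_dim s inj') eqs.
Qed.
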